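(* Let $\mathcal{I}=\langle\mathbf{C},\mathbb{X},O,tr\rangle$ be a context interactive system with $\|\mathbf{C}\|$ countable and $tr$ of countable degree, and let $T$ be an inference system such that $\mathcal{I}$ is normalizable w.r.t. $T$ and $T$ is sound w.r.t. $\langle\mathbb{X},\alpha_{\mathcal{I}}\rangle$. Then $\mathbf{Coalg}_{\mathbf{N}_T}$ has a final coalgebra, and the kernel of the unique morphism $!$ from the normalized coalgebra $\langle\mathbb{X},\alpha_{\mathcal{I}};norm_{T,\mathbb{X}}\rangle$ to it coincides with saturated bisimilarity: for all $i\in|\mathbf{C}|$ and $p,q\in X_i$, $p\sim^S_iq$ if and only if $!(p)=!(q)$.
   Context: Composition is written in diagrammatic order: $f;g$ means first $f$, then $g$. $|\mathbf{C}|$ is the set of objects and $\|\mathbf{C}\|$ the set of arrows of $\mathbf{C}$. Algebras. A $\Gamma(\mathbf{C})$-algebra $\mathbb{X}$ is a family of sets $X=(X_i)_{i\in|\mathbf{C}|}$ with a function $c_{\mathbb{X}}:X_i\to X_j$ for every $c\in\mathbf{C}[i,j]$ such that $(id_i)_{\mathbb{X}}=id_{X_i}$ and $(d;e)_{\mathbb{X}}(x)=e_{\mathbb{X}}(d_{\mathbb{X}}(x))$ (i.e. a functor $\mathbf{C}\to\mathbf{Set}$). Homomorphisms are natural transformations; the category is $\mathbf{Alg}_{\Gamma(\mathbf{C})}$. $\int X=\sum_{i}X_i$ is the disjoint union. A context interactive system is a quadruple $\langle\mathbf{C},\mathbb{X},O,tr\rangle$ with $\mathbf{C}$ a small category, $\mathbb{X}$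 a $\Gamma(\mathbf{C})$-algebra, $O$ a set (observations) and $tr\subseteq\int X\times O\times\int X$; write $p\xrightarrow{o}p'$ for $(p,o,p')\in tr$. Countable degree: each state has at most countably many outgoing transitions. Saturated bisimilarity. A family of symmetric relations $R=(R_i\subseteq X_i\times X_i)_{i\in|\mathbf{C}|}$ is a saturated bisimulation iff, for all $i,j$ and $c\in\mathbf{C}[i,j]$, whenever $p\,R_i\,q$: (1) $c_{\mathbb{X}}(p)\,R_j\,c_{\mathbb{X}}(q)$; (2) if $p\xrightarrow{o}p'$ with $p'\in X_k$, then there is $q'\in X_k$ with $q\xrightarrow{o}q'$ and $p'\,R_k\,q'$. $p\sim^S_iq$ iff $p\,R_i\,q$ for some saturated bisimulation $R$. Sets of transitions. $\mathbf{G}(X)_i$ is the set of (at most) countable subsets of $\sum_{j\in|\mathbf{C}|}\mathbf{C}[i,j]\times O\times\int X$. For a homomorphism $h$, $\mathbf{G}(h)(A)=\{(c,o,h(q))\mid (c,o,q)\in A\}$. For $p\in X_i$, $\alpha_{\mathcal{I}}(p)=\{(c,o,q)\mid c\in\mathbf{C}[i,j]\text{ for some }j,\ (c_{\mathbb{X}}(p),o,q)\in tr\}\in\mathbf{G}(X)_i$. Inference systems. An inference system $T$ is a set of rules $c\xrightarrow[o']{o}d$ with $c\in\mathbf{C}[i,i']$, $d\in\mathbf{C}[j,j']$, $o,o'\in O$. $\Phi(T)$ is the closure of $T$ together with all identity rules $id_i\xrightarrow[o]{o}id_j$ ($i,j\in|\mathbf{C}|$, $o\in O$) under: $c\xrightarrow[o']{o}c'$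 and $d\xrightarrow[o'']{o'}d'$ give $c;d\xrightarrow[o'']{o}c';d'$ whenever $c;d$ and $c';d'$ are defined. Derivation. For $d\in\mathbf{C}[i,k]$, a transition $(c_1,o_1,q_1)$ with $c_1$ of source $i$, and $(c_2,o_2,q_2)$ with $c_2$ of source $k$, write $(c_1,o_1,q_1)\vdash^{d}_{T,\mathbb{X}}(c_2,o_2,q_2)$ iff there are $e,e'\in\|\mathbf{C}\|$ with $c_1;e=d;c_2$, $e\xrightarrow[o_2]{o_1}e'\in\Phi(T)$ and $e'_{\mathbb{X}}(q_1)=q_2$. Write $\vdash_{T,\mathbb{X}}$ for $\vdash^{id}_{T,\mathbb{X}}$. $T$ is sound w.r.t. $\langle\mathbb{X},\alpha\rangle$ iff whenever $t\in\alpha(p)$ and $t\vdash^d_{T,\mathbb{X}}t'$, then $t'\in\alpha(d_{\mathbb{X}}(p))$. Normalized coalgebras. $t'\equiv_{T,\mathbb{X}}t$ iff $t'\vdash_{T,\mathbb{X}}t$ and $t\vdash_{T,\mathbb{X}}t'$. $t'\prec_{T,\mathbb{X}}t$ ($t'$ dominates $t$) iff $t'\vdash_{T,\mathbb{X}}t$ and $t\nvdash_{T,\mathbb{X}}t'$. $t\in A$ is redundant in $A$ if some $t'\in A$ has $t'\prec_{T,\mathbb{X}}t$. $A$ is normalized if it contains no redundant transition and is closed under $\equiv_{T,\mathbb{X}}$. $norm_{T,\mathbb{X}}(A)=\{t'\mid \exists t\in A,\ t'\equiv_{T,\mathbb{X}}t,\ t\text{ not redundant in }A\}$. The endofunctor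 $\mathbf{N}_T$ of $\mathbf{Alg}_{\Gamma(\mathbf{C})}$ maps $\mathbb{X}$ to the algebra whose carrier of sort $i$ is the set of normalized sets in $\mathbf{G}(X)_i$, with operations $d_{\mathbf{N}_T(\mathbb{X})}(A)=norm_{T,\mathbb{X}}(\{t_2\mid \exists t_1\in A,\ t_1\vdash^{d}_{T,\mathbb{X}}t_2\})$; on arrows $h:\mathbb{X}\to\mathbb{Y}$, $\mathbf{N}_T(h)(A)=norm_{T,\mathbb{Y}}(\mathbf{G}(h)(A))$. $\mathcal{I}$ is normalizable w.r.t. $T$ iff for every $\Gamma(\mathbf{C})$-algebra $\mathbb{Y}$ there is no infinite descending chain of $\prec_{T,\mathbb{Y}}$. An $\mathbf{N}_T$-coalgebra is a pair $\langle\mathbb{X},\alpha:\mathbb{X}\to\mathbf{N}_T(\mathbb{X})\rangle$; morphisms $\langle\mathbb{X},\alpha\rangle\to\langle\mathbb{Y},\beta\rangle$ are homomorphisms $f$ with $\alpha;\mathbf{N}_T(f)=f;\beta$.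
   Formalization: It is additionally assumed that the sets defining N_T on operations and on homomorphisms are again countable, so that N_T is an endofunctor; with uncountable O this can fail, and it holds e.g. when O or T is countable. *)

(* Defs.v *)
From mathcomp Require Import all_boot.
From mathcomp Require Import boolp classical_sets functions cardinality.

Set Implicit Arguments.
Unset Strict Implicit.
Unset Printing Implicit Defensive.

Local Open Scope classical_set_scope.

Reserved Notation "f ;; g" (at level 50, left associativity).

Record category := Category {
  ob :> Type;
  hom : ob -> ob -> Type;
  idm : forall i, hom i i;
  hcomp : forall i j k, hom i j -> hom j k -> hom i k;
  comp1m : forall i j (f : hom i j), hcomp (idm i) f = f;
  compm1 : forall i j (f : hom i j), hcomp f (idm j) = f;
  compA : forall i j k l (f : hom i j) (g : hom j k) (h : hom k l),
    hcomp (hcomp f g) h = hcomp f (hcomp g h) }.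

Arguments hom {c} i j.
Arguments idm {c} i.

(* Composition is in diagrammatic order. *)
Notation "f ;; g" := (hcomp f g).

Definition arrow (C : category) : Type := {i : C & {j : C & hom i j}}.

Record algebra (C : category) := Algebra {
  carrier :> C -> Type;
  act : forall i j, hom i j -> carrier i -> carrier j;
  act_id : forall i (x : carrier i), act (idm i) x = x;
  act_comp : forall i j k (d : hom i j) (e : hom j k) (x : carrier i),
    act (d ;; e) x = act e (act d x) }.

Arguments act {C} a {i j} c x.

Record alg_hom (C : category) (X Y : algebra C) := AlgHom {
  hmap :> forall i, X i -> Y i;
  hmap_act : forall i j (c : hom i j) (x : X i),
    hmap (act X c x) = act Y c (hmap x) }.

Arguments hmap {C X Y} a {i} x : rename.

Definition state (C : category) (X : algebra C) : Type := {k : C & X k}.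

Section AlgebraCategory.
Variable C : category.

Lemma alg_hom_ext (X Y : algebra C) (f g : alg_hom X Y) :
  (forall i (x : X i), f i x = g i x) -> f = g.
Proof.
case: f g => [f Hf] [g Hg] /= fg.
have E : f = g.
  apply: functional_extensionality_dep => i.
  by apply: functional_extensionality_dep => x.
by subst g; congr AlgHom; exact: Prop_irrelevance.
Qed.

Definition alg_id (X : algebra C) : alg_hom X X :=
  @AlgHom C X X (fun i x => x) (fun i j c x => erefl).

Lemma alg_comp_subproof (X Y Z : algebra C) (f : alg_hom X Y)
    (g : alg_hom Y Z) i j (c : hom i j) (x : X i) :
  g j (f j (act X c x)) = act Z c (g i (f i x)).
Proof. by rewrite !hmap_act. Qed.

Definition alg_comp (X Y Z : algebra C) (f : alg_hom X Y)
    (g : alg_hom Y Z) : alg_hom X Z :=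
  AlgHom (alg_comp_subproof f g).

End AlgebraCategory.

Record endofunctor (C : category) := Endofunctor {
  fobj :> algebra C -> algebra C;
  fmap : forall X Y : algebra C, alg_hom X Y -> alg_hom (fobj X) (fobj Y);
  fmap_id : forall X : algebra C, fmap (alg_id X) = alg_id (fobj X);
  fmap_comp : forall (X Y Z : algebra C) (f : alg_hom X Y) (g : alg_hom Y Z),
    fmap (alg_comp f g) = alg_comp (fmap f) (fmap g) }.

Arguments fmap {C} e {X Y} f : rename.

Record coalgebra (C : category) (F : endofunctor C) := Coalgebra {
  coalg_car :> algebra C;
  coalg_str : alg_hom coalg_car (F coalg_car) }.

Arguments coalg_str {C F} c.

Record coalg_hom (C : category) (F : endofunctor C) (A B : coalgebra F) :=
  CoalgHom {
  coalg_map :> alg_hom A B;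
  coalg_mapP :
    alg_comp (coalg_str A) (fmap F coalg_map)
    = alg_comp coalg_map (coalg_str B) }.

Definition final_coalgebra (C : category) (F : endofunctor C)
    (Z : coalgebra F) : Prop :=
  forall A : coalgebra F, exists f : coalg_hom A Z, forall g, g = f.

Record context_system (C : category) (O : Type) := ContextSystem {
  cs_alg :> algebra C;
  cs_tr : set (state cs_alg * O * state cs_alg) }.

Arguments cs_tr {C O} c.

Definition countable_degree (C : category) (O : Type)
    (I : context_system C O) : Prop :=
  forall p : state I, countable [set oq : O * state I | cs_tr I (p, oq.1, oq.2)].

Definition saturated_bisimulation (C : category) (O : Type)
    (I : context_system C O) (R : forall i : C, I i -> I i -> Prop) : Prop :=
  (forall (i : C) (p q : I i), R i p q -> R i q p) /\
  forall (i : C) (p q : I i), R i p q ->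
    (forall (j : C) (c : hom i j), R j (act I c p) (act I c q)) /\
    (forall (o : O) (k : C) (p' : I k),
       cs_tr I (existT _ i p, o, existT _ k p') ->
       exists2 q' : I k, cs_tr I (existT _ i q, o, existT _ k q') & R k p' q').

Definition saturated_bisimilar (C : category) (O : Type)
    (I : context_system C O) (i : C) (p q : I i) : Prop :=
  exists2 R : forall i : C, I i -> I i -> Prop,
    saturated_bisimulation R & R i p q.

Definition transition (C : category) (O : Type) (X : algebra C) (i : C) : Type :=
  ({j : C & hom i j} * O * state X)%type.

Definition trans_map (C : category) (O : Type) (X Y : algebra C)
    (h : alg_hom X Y) (i : C) (t : transition O X i) : transition O Y i :=
  let: (c, o, existT k q) := t in (c, o, existT _ k (h k q)).

Arguments trans_map {C O X Y} h {i} t.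

Definition alpha (C : category) (O : Type) (I : context_system C O) (i : C)
    (p : I i) : set (transition O I i) :=
  [set t | let: (existT j c, o, q) := t in cs_tr I (existT _ j (act I c p), o, q)].

(* T c o o' d is the rule with source c, target d, o above the arrow and o'
   below it. *)
Definition inference_system (C : category) (O : Type) : Type :=
  forall i i' j j' : C, hom i i' -> O -> O -> hom j j' -> Prop.

Inductive Phi (C : category) (O : Type) (T : inference_system C O) :
    inference_system C O :=
| Phi_rule i i' j j' (c : hom i i') o o' (d : hom j j') :
    T _ _ _ _ c o o' d -> Phi T c o o' d
| Phi_id i j o : Phi T (idm i) o o (idm j)
| Phi_comp i i' i'' j j' j'' (c : hom i i') (d : hom i' i'')
    (c' : hom j j') (d' : hom j' j'') o o' o'' :
    Phi T c o o' c' -> Phi T d o' o'' d' ->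
    Phi T (c ;; d) o o'' (c' ;; d').

Section Derivation.
Variables (C : category) (O : Type) (T : inference_system C O).
Implicit Types X Y : algebra C.

Definition derives X (i k : C) (d : hom i k)
    (t1 : transition O X i) (t2 : transition O X k) : Prop :=
  let: (existT j1 c1, o1, existT k1 q1) := t1 in
  let: (existT j2 c2, o2, existT k2 q2) := t2 in
  exists (e : hom j1 j2) (e' : hom k1 k2),
    [/\ c1 ;; e = d ;; c2, Phi T e o1 o2 e' & act X e' q1 = q2].

Definition derives_id X (i : C) (t1 t2 : transition O X i) : Prop :=
  derives (idm i) t1 t2.

Definition sound X (al : forall i : C, X i -> set (transition O X i)) : Prop :=
  forall (i k : C) (d : hom i k) (p : X i) t t',
    al i p t -> derives d t t' -> al k (act X d p) t'.

Definition equiv X (i : C) (t' t : transition O X i) : Prop :=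
  derives_id t' t /\ derives_id t t'.

Definition dominates X (i : C) (t' t : transition O X i) : Prop :=
  derives_id t' t /\ ~ derives_id t t'.

Definition redundant X (i : C) (A : set (transition O X i)) t : Prop :=
  A t /\ exists2 t', A t' & dominates t' t.

Definition normalized X (i : C) (A : set (transition O X i)) : Prop :=
  (forall t, A t -> ~ redundant A t) /\
  (forall t t', A t -> equiv t' t -> A t').

Definition norm X (i : C) (A : set (transition O X i)) :
    set (transition O X i) :=
  [set t' | exists t, [/\ A t, equiv t' t & ~ redundant A t]].

Definition normalizable : Prop :=
  forall Y (i : C),
    ~ exists t : nat -> transition O Y i, forall n, dominates (t n.+1) (t n).

Definition derived X (i k : C) (d : hom i k) (A : set (transition O X i)) :
    set (transition O X k) :=
  [set t2 | exists2 t1, A t1 & derives d t1 t2].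

(* The functor N_T maps algebras to algebras and homomorphisms to
   homomorphisms only if the sets below, which define it on operations and on
   arrows, are again countable.  This is not automatic when O is uncountable,
   since there may be uncountably many o' with T c o o' d.  If C has
   countably many arrows, it holds as soon as for each c, o and d there are
   only countably many such o' (N_countable_branching), in particular when O
   or T is countable. *)
Definition N_countable : Prop :=
  (forall X (i k : C) (d : hom i k) (A : set (transition O X i)),
     countable A -> normalized A -> countable (norm (derived d A))) /\
  (forall X Y (h : alg_hom X Y) (i : C) (A : set (transition O X i)),
     countable A -> normalized A -> countable (norm (trans_map h @` A))).

Record Nset X (i : C) := MkNset {
  Nset_set :> set (transition O X i);
  Nset_countable : countable Nset_set;
  Nset_normalized : normalized Nset_set }.

Lemma Nset_ext X i (A B : Nset X i) : A = B :> set _ -> A = B.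
Proof.
case: A B => [A A1 A2] [B B1 B2] /= AB; subst B.
by congr MkNset; exact: Prop_irrelevance.
Qed.

Lemma derives_refl X i (t : transition O X i) : derives_id t t.
Proof.
case: t => [[[j c] o] [k q]]; exists (idm j), (idm k); split.
- by rewrite comp1m compm1.
- exact: Phi_id.
- exact: act_id.
Qed.

Lemma derives_comp X i j k (d : hom i j) (f : hom j k)
    (t1 : transition O X i) (t2 : transition O X j) (t3 : transition O X k) :
  derives d t1 t2 -> derives f t2 t3 -> derives (d ;; f) t1 t3.
Proof.
case: t1 t2 t3 => [[[j1 c1] o1] [k1 q1]] [[[j2 c2] o2] [k2 q2]].
move=> [[[j3 c3] o3] [k3 q3]] [e [e' [E1 P1 Q1]]] [g [g' [E2 P2 Q2]]].
exists (e ;; g), (e' ;; g'); split.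
- by rewrite -compA E1 compA E2 compA.
- exact: Phi_comp P1 P2.
- by rewrite act_comp Q1.
Qed.

Lemma derives_trans X i (t1 t2 t3 : transition O X i) :
  derives_id t1 t2 -> derives_id t2 t3 -> derives_id t1 t3.
Proof. by move=> H1 H2; have := derives_comp H1 H2; rewrite comp1m. Qed.

Lemma derives_idl X i k (d : hom i k) (t1 t2 : transition O X i) t3 :
  derives_id t1 t2 -> derives d t2 t3 -> derives d t1 t3.
Proof. by move=> H1 H2; have := derives_comp H1 H2; rewrite comp1m. Qed.

Lemma derives_idr X i k (d : hom i k) (t1 : transition O X i) t2 t3 :
  derives d t1 t2 -> derives_id t2 t3 -> derives d t1 t3.
Proof. by move=> H1 H2; have := derives_comp H1 H2; rewrite compm1. Qed.

Lemma derives_split X i j k (d : hom i j) (f : hom j k)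
    (t1 : transition O X i) (t3 : transition O X k) :
  derives (d ;; f) t1 t3 -> exists2 t2, derives d t1 t2 & derives f t2 t3.
Proof.
case: t1 t3 => [[[j1 c1] o1] [k1 q1]] [[[j3 c3] o3] [k3 q3]].
case=> e [e' [E P Q]].
exists (existT _ j3 (f ;; c3), o3, existT _ k3 q3).
- by exists e, e'; split=> //; rewrite E compA.
- exists (idm j3), (idm k3); split; rewrite ?compm1 ?act_id //.
  exact: Phi_id.
Qed.

Lemma derives_map X Y (h : alg_hom X Y) i k (d : hom i k)
    (t1 : transition O X i) t2 :
  derives d t1 t2 -> derives d (trans_map h t1) (trans_map h t2).
Proof.
case: t1 t2 => [[[j1 c1] o1] [k1 q1]] [[[j2 c2] o2] [k2 q2]].
by case=> e [e' [E P Q]]; exists e, e'; split=> //; rewrite -Q hmap_act.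
Qed.

Lemma derives_lift X Y (h : alg_hom X Y) i k (d : hom i k)
    (t1 : transition O X i) (t : transition O Y k) :
  derives d (trans_map h t1) t ->
  exists2 t2, derives d t1 t2 & trans_map h t2 = t.
Proof.
case: t1 t => [[[j1 c1] o1] [k1 q1]] [[[j2 c2] o2] [k2 q2]].
case=> e [e' [E P Q]].
exists (existT _ j2 c2, o2, existT _ k2 (act X e' q1)).
- by exists e, e'.
- by rewrite /= hmap_act Q.
Qed.

(* Every transition of B is derivable from one of A. *)
Definition covers X i (A B : set (transition O X i)) : Prop :=
  forall t, B t -> exists2 s, A s & derives_id s t.

Lemma covers_sub X i (A B : set (transition O X i)) :
  B `<=` A -> covers A B.
Proof. by move=> BA t /BA At; exists t => //; exact: derives_refl. Qed.

Lemma covers_trans X i (A B D : set (transition O X i)) :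
  covers A B -> covers B D -> covers A D.
Proof.
move=> AB BD t /BD[s /AB[r Ar rs] st].
by exists r => //; exact: derives_trans rs st.
Qed.

Lemma covers_normr X i (A : set (transition O X i)) : covers A (norm A).
Proof. by move=> t [s [As [_ st] _]]; exists s. Qed.

Lemma covers_norml X i (A : set (transition O X i)) :
  normalizable -> covers (norm A) A.
Proof.
move=> nz t At; apply: contrapT => noS.
pose S := {s | A s /\ derives_id s t}.
have step (s : S) : {s' : S | dominates (sval s') (sval s)}.
  case: s => s [As st] /=; apply: cid.
  case: (pselect (redundant A s)) => [[_ [s' As' s's]]|nr].
    have s't : derives_id s' t by exact: derives_trans s's.1 st.
    by exists (exist _ s' (conj As' s't)).
  case: noS; exists s => //; exists s.
  by split=> //; split; exact: derives_refl.
pose u0 : S := exist _ t (conj At (derives_refl t)).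
pose u := fix u n : S := if n is m.+1 then sval (step (u m)) else u0.
apply: (nz X i); exists (fun n => sval (u n)) => n /=.
by case: (step (u n)).
Qed.

Lemma norm_covers X i (A B : set (transition O X i)) :
  covers A B -> covers B A -> norm A = norm B.
Proof.
suff sub (D E : set (transition O X i)) :
    covers D E -> covers E D -> norm D `<=` norm E.
  by move=> AB BA; apply/seteqP; split; apply: sub.
move=> DE ED t' [t [Dt [t't tt'] nr]].
have [b Eb bt] := ED _ Dt.
have max d : D d -> derives_id d t -> derives_id t d.
  move=> Dd dt; apply: contrapT => ntd.
  by apply: nr; split=> //; exists d.
have [a Da ab] := DE _ Eb.
have tb : derives_id t b.
  by apply: (derives_trans _ ab); apply: (max _ Da _); exact: derives_trans ab bt.
exists b; split=> //.
  by split; [exact: derives_trans t't tb | exact: derives_trans bt tt'].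
move=> [_ [b' Eb' [b'b nbb']]]; have [a' Da' a'b'] := DE _ Eb'.
apply: nbb'; apply: (derives_trans bt _); apply: (derives_trans _ a'b').
apply: (max _ Da' _); apply: (derives_trans a'b' _); exact: derives_trans b'b bt.
Qed.

Lemma normK X i (A : set (transition O X i)) : normalized A -> norm A = A.
Proof.
move=> [nr cl]; apply/seteqP; split=> [t' [t [At tt _]]|t At].
  exact: cl tt.
exists t; split=> //; last exact: nr.
by split; exact: derives_refl.
Qed.

Lemma norm_normalized X i (A : set (transition O X i)) : normalized (norm A).
Proof.
split=> [t [s [As [ts st] nr]] [_ [t' [s' [As' [t's' s't'] _]] [t't ntt']]]|].
- apply: nr; split=> //; exists s' => //; split.
    by apply: (derives_trans s't' _); exact: derives_trans t't ts.
  move=> ss'; apply: ntt'; apply: (derives_trans ts _).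
  exact: derives_trans ss' s't'.
- move=> t t' [s [As [ts st] nr]] [t't tt']; exists s; split=> //; split.
    exact: derives_trans t't ts.
  exact: derives_trans st tt'.
Qed.

Lemma derived_covers X i k (d : hom i k) (A B : set (transition O X i)) :
  covers A B -> covers (derived d A) (derived d B).
Proof.
move=> AB t2 [t1 /AB[s As st1] t12].
exists t2; last exact: derives_refl.
by exists s => //; exact: derives_idl st1 t12.
Qed.

Lemma map_covers X Y (h : alg_hom X Y) i (A B : set (transition O X i)) :
  covers A B -> covers (trans_map h @` A) (trans_map h @` B).
Proof.
move=> AB _ [t /AB[s As st] <-]; exists (trans_map h s); first by exists s.
exact: derives_map.
Qed.

Lemma derived_map X Y (h : alg_hom X Y) i k (d : hom i k)
    (A : set (transition O X i)) :
  derived d (trans_map h @` A) = trans_map h @` derived d A.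
Proof.
apply/seteqP; split=> [t2 [_ [t1 At1 <-] /derives_lift[t t1t <-]]|].
  by exists t => //; exists t1.
by move=> _ [t2 [t1 At1 t12] <-]; exists (trans_map h t1);
  [exists t1 | exact: derives_map].
Qed.

Section Functor.
Hypotheses (ctb : N_countable) (nz : normalizable).

Definition N_act X (i k : C) (d : hom i k) (A : Nset X i) : Nset X k :=
  MkNset (ctb.1 X i k d A (Nset_countable A) (Nset_normalized A))
         (norm_normalized (derived d A)).

Lemma N_act_id X i (A : Nset X i) : N_act (idm i) A = A.
Proof.
apply: Nset_ext; rewrite -[RHS]normK; last exact: Nset_normalized.
apply: norm_covers.
  by apply: covers_sub => t At; exists t => //; exact: derives_refl.
by move=> t [s As st]; exists s.
Qed.

Lemma N_act_comp X i j k (d : hom i j) (e : hom j k) (A : Nset X i) :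
  N_act (d ;; e) A = N_act e (N_act d A).
Proof.
apply: Nset_ext => /=; apply: norm_covers.
  apply: (@covers_trans _ _ _ (derived e (derived d A))).
    apply: covers_sub => t3 [t2 [t1 At1 t12] t23].
    by exists t1 => //; exact: derives_comp t12 t23.
  by apply: derived_covers; exact: covers_normr.
apply: (@covers_trans _ _ _ (derived e (derived d A))).
  by apply: derived_covers; exact: covers_norml.
apply: covers_sub => t3 [t1 At1 /derives_split[t2 t12 t23]].
by exists t2 => //; exists t1.
Qed.

Definition N_obj X : algebra C := Algebra (@N_act_id X) (@N_act_comp X).

Definition N_map_fun X Y (h : alg_hom X Y) (i : C) (A : Nset X i) : Nset Y i :=
  MkNset (ctb.2 X Y h i A (Nset_countable A) (Nset_normalized A))
         (norm_normalized (trans_map h @` A)).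

Lemma N_map_act X Y (h : alg_hom X Y) i j (c : hom i j) (A : N_obj X i) :
  N_map_fun h (act (N_obj X) c A) = act (N_obj Y) c (N_map_fun h A).
Proof.
apply: Nset_ext => /=.
transitivity (norm (trans_map h @` derived c A)).
  by apply: norm_covers; apply: map_covers;
    [exact: covers_norml | exact: covers_normr].
rewrite -derived_map; apply: norm_covers; apply: derived_covers.
  exact: covers_normr.
exact: covers_norml.
Qed.

Definition N_map X Y (h : alg_hom X Y) : alg_hom (N_obj X) (N_obj Y) :=
  @AlgHom C (N_obj X) (N_obj Y) (N_map_fun h) (N_map_act h).

Lemma N_map_id X : N_map (alg_id X) = alg_id (N_obj X).
Proof.
apply: alg_hom_ext => i A; apply: Nset_ext => /=.
rewrite -[RHS]normK; last exact: Nset_normalized.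
congr norm; rewrite -[RHS]image_id; apply: eq_imagel => t _.
by case: t => [[c o] [k q]].
Qed.

Lemma N_map_comp X Y (Z : algebra C) (f : alg_hom X Y) (g : alg_hom Y Z) :
  N_map (alg_comp f g) = alg_comp (N_map f) (N_map g).
Proof.
apply: alg_hom_ext => i A; apply: Nset_ext => /=.
transitivity (norm (trans_map g @` (trans_map f @` A))).
  congr norm; rewrite image_comp; apply: eq_imagel => t _.
  by case: t => [[c o] [k q]].
by apply: norm_covers; apply: map_covers;
  [exact: covers_normr | exact: covers_norml].
Qed.

Definition N_functor : endofunctor C := Endofunctor N_map_id N_map_comp.

End Functor.

End Derivation.

Arguments N_functor {C O T} ctb nz.
Arguments N_countable {C O} T.
Arguments normalizable {C O} T.
Arguments sound {C O} T {X} al.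
Arguments norm {C O} T {X i} A.

Lemma countable_arrows_from (C : category) (i : C) :
  countable [set: arrow C] -> countable [set: {j : C & hom i j}].
Proof.
move=> /countable_injP[f finj]; apply/countable_injP.
exists (fun c => f (existT _ i c)) => c d _ _ fcd.
have E := finj (existT _ i c) (existT _ i d) (in_setT _) (in_setT _) fcd.
by have := projT2_eq E; rewrite (Prop_irrelevance (projT1_eq E) erefl).
Qed.

Lemma N_countable_branching (C : category) (O : Type)
    (T : inference_system C O) :
  countable [set: arrow C] ->
  (forall (i i' j j' : C) (c : hom i i') (d : hom j j') (o : O),
     countable [set o' | T _ _ _ _ c o o' d]) ->
  N_countable T.
Proof.
move=> cC cT.
pose S0 o := [set o] `|` \bigcup_(x in [set: arrow C * arrow C])
   [set o' | T _ _ _ _ (projT2 (projT2 x.1)) o o' (projT2 (projT2 x.2))].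
pose S := fix S n o := if n is m.+1 then \bigcup_(o1 in S m o) S m o1 else S0 o.
have cS n : forall o, countable (S n o).
  elim: n => [|n IH] o /=; last by apply: bigcup_countable => // o1 _; exact: IH.
  rewrite /S0 -bigcup2E; apply: bigcup_countable; first exact: countableP.
  move=> [|[|?]] _ /=; [exact: countable1| |exact: countable0].
  apply: bigcup_countable => [|x _]; last exact: cT.
  by rewrite -setXTT; exact: countableX.
have S1 n o : S n o o.
  by elim: n => [|n IH] /=; [left | exists o].
have Sle m n o : m <= n -> S m o `<=` S n o.
  move=> /subnK <-; elim: (n - m) => [//|k IH] o' /IH H.
  by rewrite addSn /=; exists o'.
have PS i i' j j' (c : hom i i') o o' (d : hom j j') :
    Phi T c o o' d -> exists n, S n o o'.
  elim=> {i i' j j' c o o' d}.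
  - move=> i i' j j' c o o' d H; exists 0; right.
    by exists (existT _ i (existT _ i' c), existT _ j (existT _ j' d)).
  - by move=> i j o; exists 0; left.
  - move=> i i' i'' j j' j'' c d c' d' o o' o'' _ [m Hm] _ [n Hn].
    exists (maxn m n).+1 => /=; exists o'.
      by apply: (Sle _ _ _ _ _ Hm); rewrite leq_maxl.
    by apply: (Sle _ _ _ _ _ Hn); rewrite leq_maxr.
have cD X i k (d : hom i k) (t1 : transition O X i) :
    countable [set t2 | derives T d t1 t2].
  case: t1 => [[[j1 c1] o1] [k1 q1]].
  pose F (x : {j : C & hom k j} * O * {k2 : C & hom k1 k2}) :
    transition O X k := (x.1.1, x.1.2, existT _ _ (act X (projT2 x.2) q1)).
  apply: (@sub_countable _ _ _ (F @`
    (([set: {j : C & hom k j}] `*` \bigcup_(n in [set: nat]) S n o1)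
       `*` [set: {k2 : C & hom k1 k2}]))).
    apply: subset_card_le => -[[[j2 c2] o2] [k2 q2]] [e [e' [_ P <-]]].
    exists (existT _ j2 c2, o2, existT _ k2 e') => //=.
    by split=> //; split=> //; have [n Hn] := PS _ _ _ _ _ _ _ _ P; exists n.
  apply: (@sub_countable _ _ _ _ (card_image_le _ _)).
  apply: countableX; last exact: countable_arrows_from.
  apply: countableX; first exact: countable_arrows_from.
  by apply: bigcup_countable => // n _; exact: cS.
have cN X i (A : set (transition O X i)) : countable A -> countable (norm T A).
  move=> cA; apply: (@sub_countable _ _ _
    (\bigcup_(t in A) [set t' | derives T (idm i) t t'])).
    by apply: subset_card_le => t' [t [At [_ tt'] _]]; exists t.
  by apply: bigcup_countable => // t _; exact: cD.
split=> [X i k d A cA _|X Y h i A cA _]; apply: cN.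
  apply: (@sub_countable _ _ _
    (\bigcup_(t in A) [set t' | derives T d t t'])).
    by apply: subset_card_le => t' [t At tt']; exists t.
  by apply: bigcup_countable => // t _; exact: cD.
exact: sub_countable (card_image_le _ _) cA.
Qed.

Section NormalizedCoalgebra.
Variables (C : category) (O : Type) (I : context_system C O).
Variable T : inference_system C O.
Hypotheses (cC : countable [set: arrow C]) (cI : countable_degree I).
Hypotheses (ctb : N_countable T) (nz : normalizable T).
Hypothesis sndT : sound T (@alpha C O I).

Lemma alpha_countable i (p : I i) : countable (alpha p).
Proof.
apply: (@sub_countable _ _ _ (\bigcup_(c in [set: {j : C & hom i j}])
  ((fun oq : O * state I => (c, oq.1, oq.2)) @`
   [set oq | cs_tr I (existT _ _ (act I (projT2 c) p), oq.1, oq.2)]))).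
  apply: subset_card_le => -[[[j c] o] q] /= H.
  by exists (existT _ j c) => //; exists (o, q).
apply: bigcup_countable => [|c _]; first exact: countable_arrows_from.
exact: sub_countable (card_image_le _ _) (cI _).
Qed.

Lemma norm_alpha_countable i (p : I i) : countable (norm T (alpha p)).
Proof.
apply: sub_countable (alpha_countable p); apply: subset_card_le.
by move=> t' [t [At [_ tt'] _]]; have := sndT At tt'; rewrite act_id.
Qed.

Definition norm_alpha (i : C) (p : I i) : N_functor ctb nz I i :=
  MkNset (norm_alpha_countable p) (norm_normalized T (alpha p)).

Lemma norm_alpha_act i j (c : hom i j) (p : I i) :
  norm_alpha (act I c p) = act (N_functor ctb nz I) c (norm_alpha p).
Proof.
apply: Nset_ext => /=.
transitivity (norm T (derived T c (alpha p))).
  congr norm; apply/seteqP; split=> [|t2 [t1 At1 t12]]; last exact: sndT At1 t12.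
  move=> [[[k f] o] [l q]] /= H.
  exists (existT _ k (c ;; f), o, existT _ l q) => /=; first by rewrite act_comp.
  exists (idm k), (idm l); split; rewrite ?compm1 ?act_id //; exact: Phi_id.
by apply: norm_covers; apply: derived_covers;
  [exact: covers_normr | exact: covers_norml].
Qed.

Definition normalized_coalgebra : coalgebra (N_functor ctb nz) :=
  Coalgebra (AlgHom norm_alpha_act).

End NormalizedCoalgebra.

(* Main.v *)
(* An N_T-coalgebra X is the same thing as a context interactive system on X
   whose transitions are closed under derivation: p -o-> q iff (id, o, q) is
   derivable from str p.  Since t |-^c (id, o, q) iff t |- (c, o, q), all
   transitions derivable from str p are recovered as alpha p, and since norm
   only depends on the transitions derivable from a set, coalgebra morphisms
   are exactly the homomorphisms whose graph is a saturated bisimulation.  A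
   state reaches only countably many states, so every state of every coalgebra
   lies in the image of a coalgebra whose carriers are subsets of nat.  The
   coproduct of all those, divided by bisimilarity, is final.  Soundness makes
   the system of the normalized coalgebra of I equal to I. *)

Require Import Defs.
From mathcomp Require Import all_boot.
From mathcomp Require Import boolp classical_sets functions cardinality.

Set Implicit Arguments.
Unset Strict Implicit.
Unset Printing Implicit Defensive.

Local Open Scope classical_set_scope.

(** Proof irrelevance turns the extracted equality on the index into [erefl], which makes the
    transport trivial. *)
Lemma existT_inj (K : Type) (P : K -> Type) (k : K) (x y : P k) :
  existT P k x = existT P k y -> x = y.
Proof.
by move=> E; have := projT2_eq E; rewrite (Prop_irrelevance (projT1_eq E) erefl).
Qed.

(** * Bisimulations between two systems *)

Section Bisimilarity.
Variables (C : category) (O : Type).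
Implicit Types I J K : context_system C O.

(** Symmetry makes no sense between two different systems, so both transfer conditions are imposed;
    a state can then be compared with its image under a morphism. *)
Definition bisimulation I J (R : forall i : C, I i -> J i -> Prop) : Prop :=
  forall (i : C) (p : I i) (q : J i), R i p q ->
    [/\ forall (j : C) (c : hom i j), R j (act I c p) (act J c q),
        forall (o : O) (k : C) (p' : I k),
          cs_tr I (existT _ i p, o, existT _ k p') ->
          exists2 q' : J k, cs_tr J (existT _ i q, o, existT _ k q') & R k p' q'
      & forall (o : O) (k : C) (q' : J k),
          cs_tr J (existT _ i q, o, existT _ k q') ->
          exists2 p' : I k, cs_tr I (existT _ i p, o, existT _ k p') & R k p' q'].

Definition bisimilar I J (i : C) (p : I i) (q : J i) : Prop :=
  exists2 R : forall i : C, I i -> J i -> Prop, bisimulation R & R i p q.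

Lemma bisimulation_sym I J (R : forall i : C, I i -> J i -> Prop) :
  bisimulation R -> bisimulation (fun i q p => R i p q).
Proof. by move=> bR i q p /bR[]. Qed.

Lemma bisimilar_bisimulation I J : bisimulation (@bisimilar I J).
Proof.
move=> i p q [R bR /bR[Ra Rf Rb]]; split.
- by move=> j c; exists R.
- by move=> o k p' /Rf[q' tq' Rpq']; exists q' => //; exists R.
- by move=> o k q' /Rb[p' tp' Rpq']; exists p' => //; exists R.
Qed.

Lemma bisimilar_refl I i (p : I i) : bisimilar p p.
Proof.
exists (fun i => eq) => // {p}i p _ <-; split=> // o k p' tp'; by exists p'.
Qed.

Lemma bisimilar_sym I J i (p : I i) (q : J i) : bisimilar p q -> bisimilar q p.
Proof. by move=> [R bR Rpq]; exists (fun i q p => R i p q) => //; exact: bisimulation_sym. Qed.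

Lemma bisimilar_trans I J K i (p : I i) (q : J i) (r : K i) :
  bisimilar p q -> bisimilar q r -> bisimilar p r.
Proof.
move=> pq qr; exists (fun i (p : I i) (r : K i) =>
  exists2 q : J i, bisimilar p q & bisimilar q r); last by exists q.
move=> {p q r pq qr}i p r [q /bisimilar_bisimulation[pa pf pb]].
move=> /bisimilar_bisimulation[qa qf qb]; split.
- by move=> j c; exists (act J c q).
- by move=> o k p' /pf[q' /qf[r' tr' qr'] pq']; exists r' => //; exists q'.
- by move=> o k r' /qb[q' /pb[p' tp' pq'] qr']; exists p' => //; exists q'.
Qed.

Lemma bisimulation_alpha I J (R : forall i : C, I i -> J i -> Prop)
    i (p : I i) (q : J i) c o k (p' : I k) :
  bisimulation R -> R i p q -> alpha p (c, o, existT _ k p') ->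
  exists2 q' : J k, alpha q (c, o, existT _ k q') & R k p' q'.
Proof. by case: c => j c bR /bR[/(_ j c)/bR[_ Rf _] _ _] /Rf. Qed.

(** Symmetry of a saturated bisimulation yields the backward condition. Conversely a given
    bisimulation may fail to be symmetric, so the witness is bisimilarity itself. *)
Lemma saturated_bisimilarE I i (p q : I i) :
  saturated_bisimilar p q <-> bisimilar p q.
Proof.
split=> [[R [sR bR] Rpq]|pq].
  exists R => // {Rpq}j x y Rxy; have [Ra Rf] := bR j x y Rxy; split=> //.
  move=> o k q' /(proj2 (bR _ _ _ (sR _ _ _ Rxy)))[p' tp' /sR Rpq'].
  by exists p'.
exists (@bisimilar I I) => //; split=> [j x y|j x y]; first exact: bisimilar_sym.
by move=> /bisimilar_bisimulation[].
Qed.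

End Bisimilarity.

(** * Coalgebras as context interactive systems *)

Section Coalgebras.
Variables (C : category) (O : Type) (T : inference_system C O).
Hypotheses (ctb : N_countable T) (nz : normalizable T).
Local Notation F := (N_functor ctb nz).

Definition system_of (X : coalgebra F) : context_system C O :=
  @ContextSystem C O X [set x | let: (existT i p, o, q) := x in
    exists2 t, Nset_set (coalg_str X i p) t
             & derives T (idm i) t (existT _ i (idm i), o, q)].

Coercion system_of : coalgebra >-> context_system.

(** The homomorphism law replaces the structure at [act X c p] by the norm of the set derived along
    [c]. This norm and this set cover each other, so [norm] disappears where only derivability
    matters. *)
Lemma alpha_system_of (X : coalgebra F) i (p : X i) :
  @alpha _ _ X i p = derived T (idm i) (Nset_set (coalg_str X i p)).
Proof.
have idE (j : C) (c : hom i j) t o q :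
    derives T c t (existT _ j (idm j), o, q)
    <-> derives T (idm i) t (existT (hom i) j c, o, q).
  by case: t q => [[[j1 c1] o1] [k1 q1]] [k q] /=; rewrite comp1m compm1.
apply/seteqP; split=> -[[[j c] o] q] /=; rewrite hmap_act /=.
  move=> [s /covers_normr[s' [t pt ts'] s's] sq]; exists t => //; apply/idE.
  exact: derives_idr ts' (derives_trans s's sq).
move=> [t pt /idE tq].
have [|s As sq] := @covers_norml _ _ _ _ _
    (derived T c (Nset_set (coalg_str X i p))) nz (existT _ j (idm j), o, q).
  by exists t.
by exists s.
Qed.

Lemma alpha_coalg_str (X : coalgebra F) i (p : X i) t :
  Nset_set (coalg_str X i p) t -> @alpha _ _ X i p t.
Proof.
by move=> pt; rewrite alpha_system_of; exists t => //; exact: derives_refl.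
Qed.

Lemma trans_map_eq (X Y : algebra C) (h : alg_hom X Y) i (t : transition O X i)
    c o k (y : Y k) :
  trans_map h t = (c, o, existT _ k y) ->
  exists2 x : X k, t = (c, o, existT _ k x) & h k x = y.
Proof.
case: t => [[c' o'] [k' x]] /= E.
have Ec : c' = c by have := congr1 (fun t => t.1.1) E.
have Eo : o' = o by have := congr1 (fun t => t.1.2) E.
have E2 : existT Y k' (h k' x) = existT Y k y by have := congr1 snd E.
have Ek : k' = k by have := congr1 (@projT1 _ _) E2.
by subst; exists x => //; exact: existT_inj E2.
Qed.

(** * Coalgebra morphisms and functional bisimulations *)

(** The morphism law says that the structure at [f i x] is the norm of the image of the structure at
    [x]. Forward, normalizability gives an element of the norm that derives the image of a
    transition. Backward, a derivation from an image lifts along [f]. *)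
Lemma coalg_hom_bisimulation (X Y : coalgebra F) (f : coalg_hom X Y) :
  @bisimulation _ _ X Y (fun i x y => f i x = y).
Proof.
move=> i x _ <-; have /(congr1 (fun h : alg_hom X (F Y) =>
  Nset_set (h i x))) /= E := coalg_mapP f.
split=> [j c|o k x' [t xt tx']|o k y'].
- exact: hmap_act.
- exists (f k x') => //.
  have [|s As st] := @covers_norml _ _ _ _ _
    (trans_map f @` Nset_set (coalg_str X i x)) nz (trans_map f t).
    by exists t.
  exists s; first by rewrite -E.
  exact: (derives_trans st (derives_map f tx')).
- rewrite /= -E => -[s /covers_normr[_ [t xt <-] ts] sy].
  have [t2 tt2 /trans_map_eq[x' t2E <-]] := derives_lift (derives_trans ts sy).
  by exists x' => //; exists t => //; rewrite -t2E.
Qed.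

Lemma coalg_hom_bisimilar (X Y : coalgebra F) (f : coalg_hom X Y) i (x : X i) :
  @bisimilar _ _ X Y i x (f i x).
Proof. by eexists; first exact: coalg_hom_bisimulation f. Qed.

(* Any R is allowed, not only the kernel of (f, g): this gives at once that the
   structure of a quotient is well defined and, with g the identity, that a
   functional bisimulation is a coalgebra morphism. *)
Lemma fmap_bisimulation (X Y : coalgebra F) (Z : algebra C) (f : alg_hom X Z)
    (g : alg_hom Y Z) (R : forall i : C, X i -> Y i -> Prop) i (x : X i) (y : Y i) :
  @bisimulation _ _ X Y R ->
  (forall i x y, R i x y -> f i x = g i y) -> R i x y ->
  fmap F f i (coalg_str X i x) = fmap F g i (coalg_str Y i y).
Proof.
have half (X' Y' : coalgebra F) (f' : alg_hom X' Z) (g' : alg_hom Y' Z)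
    (R' : forall i : C, X' i -> Y' i -> Prop) (x' : X' i) (y' : Y' i) :
    @bisimulation _ _ X' Y' R' ->
    (forall i x y, R' i x y -> f' i x = g' i y) -> R' i x' y' ->
    covers T (trans_map f' @` Nset_set (coalg_str X' i x'))
             (trans_map g' @` Nset_set (coalg_str Y' i y')).
  move=> bR fg Rxy _ [[[c o] [k y2]] /alpha_coalg_str yt <-].
  have [x2] := bisimulation_alpha (bisimulation_sym bR) Rxy yt.
  rewrite alpha_system_of => -[t xt tx2] Rxy2.
  exists (trans_map f' t); first by exists t.
  by rewrite /= -(fg _ _ _ Rxy2); exact: (derives_map f' tx2).
move=> bR fg Rxy; apply: Nset_ext; apply: norm_covers; first exact: half Rxy.
apply: (half _ _ _ _ (fun i y x => R i x y)) => //.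
  exact: bisimulation_sym.
by move=> j y2 x2 /fg.
Qed.

Lemma coalg_hom_of_bisimulation (X Y : coalgebra F) (f : alg_hom X Y) :
  @bisimulation _ _ X Y (fun i x y => f i x = y) ->
  exists g : coalg_hom X Y, coalg_map g = f.
Proof.
move=> bf; suff E : alg_comp (coalg_str X) (fmap F f) = alg_comp f (coalg_str Y).
  by exists (CoalgHom E).
apply: alg_hom_ext => i x /=.
(* The right-hand side becomes an image under [fmap] of the identity, the shape that
   [fmap_bisimulation] expects. *)
rewrite -[RHS](congr1 (fun h : alg_hom (F Y) (F Y) => h i _) (fmap_id F Y)).
exact: (fmap_bisimulation bf).
Qed.

Lemma coalg_hom_ext (X Y : coalgebra F) (f g : coalg_hom X Y) :
  (forall i (x : X i), f i x = g i x) -> f = g.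
Proof.
move=> /alg_hom_ext; case: f g => [f Hf] [g Hg] /= fg; subst g.
by congr CoalgHom; exact: Prop_irrelevance.
Qed.

Lemma coalg_comp_subproof (X Y Z : coalgebra F) (f : coalg_hom X Y)
    (g : coalg_hom Y Z) :
  alg_comp (coalg_str X) (fmap F (alg_comp f g))
  = alg_comp (alg_comp f g) (coalg_str Z).
Proof.
apply: alg_hom_ext => i x; rewrite fmap_comp /=.
have /= := congr1 (fun h : alg_hom X (F Y) => h i x) (coalg_mapP f).
move=> ->.
exact: (congr1 (fun h : alg_hom Y (F Z) => h i (f i x)) (coalg_mapP g)).
Qed.

Definition coalg_comp (X Y Z : coalgebra F) (f : coalg_hom X Y)
    (g : coalg_hom Y Z) : coalg_hom X Z := CoalgHom (coalg_comp_subproof f g).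

(** * Quotient of a coalgebra by bisimilarity *)

Section Quotient.
Variable X : coalgebra F.

Definition bisim_class (i : C) : Type :=
  {A : set (X i) | exists x, A = @bisimilar _ _ X X i x}.

Definition class_of i (x : X i) : bisim_class i :=
  exist _ (@bisimilar _ _ X X i x) (ex_intro _ x erefl).

Lemma class_of_surj i (z : bisim_class i) : {x | class_of x = z}.
Proof.
apply: cid; case: z => A [x Ax]; exists x; subst A.
by congr exist; exact: Prop_irrelevance.
Qed.

Definition class_repr i (z : bisim_class i) : X i := sval (class_of_surj z).

Lemma class_reprK i (z : bisim_class i) : class_of (class_repr z) = z.
Proof. exact: svalP (class_of_surj z). Qed.

Lemma class_of_eq i (x y : X i) :
  class_of x = class_of y <-> @bisimilar _ _ X X i x y.
Proof.
split=> [/(congr1 (fun z : bisim_class i => sval z y)) /= ->|xy].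
  exact: bisimilar_refl.
have E : @bisimilar _ _ X X i x = @bisimilar _ _ X X i y.
  apply/seteqP; split=> z; last exact: bisimilar_trans.
  by apply: bisimilar_trans; exact: bisimilar_sym.
(* The existence proof is generalized because its type depends on the class being rewritten. *)
by rewrite /class_of; move: (ex_intro _ x _); rewrite E => ex;
  congr exist; exact: Prop_irrelevance.
Qed.

Definition class_act i j (c : hom i j) (z : bisim_class i) : bisim_class j :=
  class_of (act X c (class_repr z)).

Lemma class_actE i j (c : hom i j) (x : X i) :
  class_act c (class_of x) = class_of (act X c x).
Proof.
have /class_of_eq/bisimilar_bisimulation[xa _ _] := class_reprK (class_of x).
by apply/class_of_eq; exact: xa.
Qed.

Lemma class_act_id i (z : bisim_class i) : class_act (idm i) z = z.
Proof. by rewrite -(class_reprK z) class_actE act_id. Qed.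

Lemma class_act_comp i j k (d : hom i j) (e : hom j k) (z : bisim_class i) :
  class_act (d ;; e) z = class_act e (class_act d z).
Proof. by rewrite -(class_reprK z) !class_actE act_comp. Qed.

Definition quot_alg : algebra C := Algebra class_act_id class_act_comp.

Definition quot_map : alg_hom X quot_alg :=
  @AlgHom C X quot_alg class_of (fun i j c x => esym (class_actE c x)).

Definition quot_str i (z : quot_alg i) : F quot_alg i :=
  fmap F quot_map i (coalg_str X i (class_repr z)).

(** Independence of the representative: bisimilar states have structures with the same image in the
    quotient. Hence the projection is a coalgebra morphism. *)
Lemma quot_strE i (x : X i) :
  quot_str (quot_map i x) = fmap F quot_map i (coalg_str X i x).
Proof.
apply: (@fmap_bisimulation X X _ quot_map quot_map (@bisimilar _ _ X X)).
- exact: bisimilar_bisimulation.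
- by move=> j y z /class_of_eq.
- exact/class_of_eq/class_reprK.
Qed.

Lemma quot_str_act i j (c : hom i j) (z : quot_alg i) :
  quot_str (act quot_alg c z) = act (F quot_alg) c (quot_str z).
Proof.
rewrite -(class_reprK z) -[class_of _]/(quot_map i _) -hmap_act !quot_strE.
by rewrite !hmap_act.
Qed.

Definition quot_coalg : coalgebra F := Coalgebra (AlgHom quot_str_act).

Lemma quot_map_coalg :
  alg_comp (coalg_str X) (fmap F quot_map)
  = alg_comp quot_map (coalg_str quot_coalg).
Proof. by apply: alg_hom_ext => i x; exact/esym/quot_strE. Qed.

Definition quot_hom : coalg_hom X quot_coalg :=
  @CoalgHom C F X quot_coalg quot_map quot_map_coalg.

Lemma quot_hom_eq i (x y : X i) :
  quot_hom i x = quot_hom i y <-> @bisimilar _ _ X X i x y.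
Proof. exact: class_of_eq. Qed.

(** The projection is a morphism, so each class is bisimilar to its representative; bisimilar
    classes thus have bisimilar representatives and coincide. *)
Lemma quot_coalg_bisimilar i (y z : quot_coalg i) :
  @bisimilar _ _ quot_coalg quot_coalg i y z -> y = z.
Proof.
move=> yz; rewrite -(class_reprK y) -(class_reprK z); apply/class_of_eq.
have xz v : @bisimilar _ _ X quot_coalg i (class_repr v) v.
  by rewrite -{2}(class_reprK v); exact: (coalg_hom_bisimilar quot_hom).
apply: bisimilar_trans (xz y) _; apply: bisimilar_trans yz _.
exact/bisimilar_sym/xz.
Qed.

End Quotient.

(** * Coproducts of coalgebras *)

Section Coproduct.
Variables (S : Type) (X : S -> coalgebra F).

Definition coprod_act i j (c : hom i j) (x : {s : S & X s i}) :
    {s : S & X s j} :=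
  existT _ (projT1 x) (act (X (projT1 x)) c (projT2 x)).

Lemma coprod_act_id i (x : {s : S & X s i}) : coprod_act (idm i) x = x.
Proof. by case: x => s x; rewrite /coprod_act /= act_id. Qed.

Lemma coprod_act_comp i j k (d : hom i j) (e : hom j k) (x : {s : S & X s i}) :
  coprod_act (d ;; e) x = coprod_act e (coprod_act d x).
Proof. by rewrite /coprod_act /= act_comp. Qed.

Definition coprod_alg : algebra C := Algebra coprod_act_id coprod_act_comp.

Definition coprod_in s : alg_hom (X s) coprod_alg :=
  @AlgHom C (X s) coprod_alg (fun i x => existT _ s x) (fun i j c x => erefl).

Definition coprod_str i (x : coprod_alg i) : F coprod_alg i :=
  fmap F (coprod_in (projT1 x)) i (coalg_str (X (projT1 x)) i (projT2 x)).

Lemma coprod_str_act i j (c : hom i j) (x : coprod_alg i) :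
  coprod_str (act coprod_alg c x) = act (F coprod_alg) c (coprod_str x).
Proof. by rewrite /coprod_str -[RHS]hmap_act -[X in _ = fmap _ _ _ X]hmap_act. Qed.

Definition coprod_coalg : coalgebra F := Coalgebra (AlgHom coprod_str_act).

Lemma coprod_in_coalg s :
  alg_comp (coalg_str (X s)) (fmap F (coprod_in s))
  = alg_comp (coprod_in s) (coalg_str coprod_coalg).
Proof. exact: alg_hom_ext. Qed.

Definition coprod_hom s : coalg_hom (X s) coprod_coalg :=
  @CoalgHom C F (X s) coprod_coalg (coprod_in s) (coprod_in_coalg s).

End Coproduct.

(** * Subcoalgebras *)

(* A coalgebra structure on Y making the family of injections g a morphism. *)
Section Restriction.
Variables (X : coalgebra F) (Y : C -> Type) (g : forall i, Y i -> X i).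
Hypothesis g_inj : forall i, injective (@g i).
Hypothesis g_act : forall i j (c : hom i j) (y : Y i),
  exists y' : Y j, g y' = act X c (g y).
Hypothesis g_str : forall i (y : Y i) c o k (x : X k),
  Nset_set (coalg_str X i (g y)) (c, o, existT _ k x) ->
  exists y' : Y k, g y' = x.

Definition restr_act i j (c : hom i j) (y : Y i) : Y j := sval (cid (g_act c y)).

Lemma restr_actE i j (c : hom i j) (y : Y i) : g (restr_act c y) = act X c (g y).
Proof. exact: svalP (cid (g_act c y)). Qed.

Lemma restr_act_id i (y : Y i) : restr_act (idm i) y = y.
Proof. by apply: g_inj; rewrite restr_actE act_id. Qed.

Lemma restr_act_comp i j k (d : hom i j) (e : hom j k) (y : Y i) :
  restr_act (d ;; e) y = restr_act e (restr_act d y).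
Proof. by apply: g_inj; rewrite !restr_actE act_comp. Qed.

Definition restr_alg : algebra C := Algebra restr_act_id restr_act_comp.

Definition restr_in : alg_hom restr_alg X :=
  @AlgHom C restr_alg X g (fun i j c y => restr_actE c y).

Lemma restr_trans_inj i (t1 t2 : transition O restr_alg i) :
  trans_map restr_in t1 = trans_map restr_in t2 -> t1 = t2.
Proof.
case: t2 => [[c o] [k y]] /trans_map_eq[y' -> E].
by rewrite (g_inj E).
Qed.

(** A derivation between images lifts to one whose end has the right image, and injectivity
    identifies that end with [t2]. *)
Lemma restr_derives i k (d : hom i k) (t1 : transition O restr_alg i) t2 :
  derives T d (trans_map restr_in t1) (trans_map restr_in t2)
  <-> derives T d t1 t2.
Proof.
split=> [/derives_lift[t t1t /restr_trans_inj <-] //|]; exact: derives_map.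
Qed.

Definition restr_set i (y : Y i) : set (transition O restr_alg i) :=
  trans_map restr_in @^-1` Nset_set (coalg_str X i (g y)).

Lemma restr_set_image i (y : Y i) :
  trans_map restr_in @` restr_set y = Nset_set (coalg_str X i (g y)).
Proof.
apply/seteqP; split=> [_ [t yt <-] //|[[c o] [k x]] yt].
have [y' E] := g_str yt; exists (c, o, existT _ k y') => //=.
  by rewrite /restr_set /= E.
by rewrite /= E.
Qed.

Lemma restr_set_countable i (y : Y i) : countable (restr_set y).
Proof.
have /countable_injP[f finj] := Nset_countable (coalg_str X i (g y)).
apply/countable_injP; exists (f \o trans_map restr_in) => t1 t2.
rewrite !inE => y1 y2 /finj E; apply: restr_trans_inj; apply: E; exact/mem_set.
Qed.

Lemma restr_set_normalized i (y : Y i) : normalized T (restr_set y).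
Proof.
have [nr cl] := Nset_normalized (coalg_str X i (g y)).
split=> [t yt [_ [t' yt' [t't ntt']]]|t t' yt [t't tt']].
  apply: (nr _ yt); split=> //; exists (trans_map restr_in t') => //.
  by split; [exact/restr_derives | move=> /restr_derives].
by apply: (cl _ _ yt); split; exact/restr_derives.
Qed.

Definition restr_str i (y : restr_alg i) : F restr_alg i :=
  MkNset (restr_set_countable y) (restr_set_normalized y).

Lemma restr_strE i (y : restr_alg i) :
  fmap F restr_in i (restr_str y) = coalg_str X i (restr_in i y).
Proof.
by apply: Nset_ext; rewrite /= restr_set_image normK; last exact: Nset_normalized.
Qed.

(** This pulls the homomorphism law of [restr_str] back from [X]. If the images of two normalized
    sets have the same norm, the sets cover each other because [restr_in] reflects derivability, and
    normalized sets covering each other are equal. *)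
Lemma fmap_restr_in_inj i : injective (fmap F restr_in i).
Proof.
suff half (A B : F restr_alg i) : fmap F restr_in i A = fmap F restr_in i B ->
    covers T (Nset_set A) (Nset_set B).
  move=> A B AB; apply: Nset_ext.
  rewrite -[LHS](normK (Nset_normalized A)) -[RHS](normK (Nset_normalized B)).
  by apply: norm_covers; exact: half.
move=> /(congr1 (@Nset_set _ _ _ _ _)) /= AB t Bt.
have [s] := @covers_norml _ _ T _ _ (trans_map restr_in @` Nset_set B) nz
  (trans_map restr_in t) (ex_intro2 _ _ t Bt erefl).
rewrite -AB => /covers_normr[_ [r Ar <-] rs] st; exists r => //.
by apply/restr_derives; exact: derives_trans rs st.
Qed.

Lemma restr_str_act i j (c : hom i j) (y : restr_alg i) :
  restr_str (act restr_alg c y) = act (F restr_alg) c (restr_str y).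
Proof.
by apply: fmap_restr_in_inj; rewrite hmap_act !restr_strE !hmap_act.
Qed.

Definition restr_coalg : coalgebra F := Coalgebra (AlgHom restr_str_act).

Lemma restr_in_coalg :
  alg_comp (coalg_str restr_coalg) (fmap F restr_in)
  = alg_comp restr_in (coalg_str X).
Proof. by apply: alg_hom_ext => i y; exact: restr_strE. Qed.

Definition restr_hom : coalg_hom restr_coalg X :=
  @CoalgHom C F restr_coalg X restr_in restr_in_coalg.

End Restriction.

(** * Countability of the states reachable from a state *)

Section Generated.
Hypothesis cC : countable [set: arrow C].
Variable (X : coalgebra F).

Definition successors (s : state X) : set (state X) :=
  [set u | exists j (c : hom (projT1 s) j), u = existT _ j (act X c (projT2 s))]
  `|` [set u | exists c o, Nset_set (coalg_str X _ (projT2 s)) (c, o, u)].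

Lemma successors_countable s : countable (successors s).
Proof.
case: s => i x; rewrite /successors /= -bigcup2E.
apply: bigcup_countable; first exact: countableP.
move=> [|[|?]] _ /=; last exact: countable0.
  apply: (@sub_countable _ _ _ ((fun c : {j : C & hom i j} =>
    existT (carrier X) _ (act X (projT2 c) x)) @` setT)).
    by apply: subset_card_le => _ [j [c ->]]; exists (existT _ j c).
  apply: sub_countable (card_image_le _ _) _; exact: countable_arrows_from.
apply: (@sub_countable _ _ _ (snd @` Nset_set (coalg_str X i x))).
  by apply: subset_card_le => u [c [o xu]]; exists (c, o, u).
exact: sub_countable (card_image_le _ _) (Nset_countable _).
Qed.

Fixpoint reachable_in (s : state X) (n : nat) : set (state X) :=
  if n is m.+1 then \bigcup_(u in reachable_in s m) successors u else [set s].

(** Closed under the operations and under targets of structure transitions, this set carries a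
    subcoalgebra through [s]. *)
Definition reachable s : set (state X) :=
  \bigcup_(n in [set: nat]) reachable_in s n.

Lemma reachable_countable s : countable (reachable s).
Proof.
apply: bigcup_countable => // n _; elim: n => [|n IH] /=; first exact: countable1.
by apply: bigcup_countable => // u _; exact: successors_countable.
Qed.

Lemma reachable_refl s : reachable s s.
Proof. by exists 0. Qed.

Lemma reachable_succ s u v : reachable s u -> successors u v -> reachable s v.
Proof. by move=> [n _ sn] uv; exists n.+1 => //; exists u. Qed.

End Generated.

(** * Construction of the final coalgebra *)

(* The fields of an algebra are inlined because a field of type algebra C would
   put this record one universe too high to index a coproduct in algebra C. *)
Record nat_coalgebra := NatCoalgebra {
  nc_car : C -> set nat;
  nc_act : forall i j, hom i j -> {n | nc_car i n} -> {n | nc_car j n};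
  nc_act_id : forall i (x : {n | nc_car i n}), nc_act (idm i) x = x;
  nc_act_comp : forall i j k (d : hom i j) (e : hom j k) (x : {n | nc_car i n}),
    nc_act (d ;; e) x = nc_act e (nc_act d x);
  nc_str : alg_hom (Algebra nc_act_id nc_act_comp)
                   (F (Algebra nc_act_id nc_act_comp)) }.

Definition coalg_of (s : nat_coalgebra) : coalgebra F := Coalgebra (nc_str s).

(** The subcoalgebra of states reachable from [x] is countable, hence isomorphic to one on subsets
    of nat. *)
Lemma nat_coalgebra_cover (cC : countable [set: arrow C]) (X : coalgebra F) i
    (x : X i) :
  exists (s : nat_coalgebra) (f : coalg_hom (coalg_of s) X) y, f i y = x.
Proof.
pose s : state X := existT _ i x.
have /countable_injP[f finj] := reachable_countable cC s.
(* [P j] holds the codes under [f] of the reachable states of sort [j]; [g] below decodes them. *)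
pose P (j : C) : set nat :=
  [set n | exists2 y : X j, reachable s (existT _ j y) & f (existT _ j y) = n].
have Pex j (n : {n | P j n}) :
    exists y : X j, reachable s (existT _ j y) /\ f (existT _ j y) = sval n.
  by case: n => n [y]; exists y.
pose g j (n : {n | P j n}) : X j := sval (cid (Pex j n)).
have gs j n : reachable s (existT _ j (g j n)).
  by rewrite /g; case: cid => y [].
have fg j n : f (existT _ j (g j n)) = sval n.
  by rewrite /g; case: cid => y [].
have ginj j : injective (@g j).
  move=> m n E; have := fg j m; rewrite E fg => {}E.
  case: m n E => [m Pm] [n Pn] /= E; subst n; congr exist; exact: Prop_irrelevance.
have gsurj j (y : X j) : reachable s (existT _ j y) -> exists n, g j n = y.
  move=> sy; exists (exist _ _ (ex_intro2 _ _ y sy erefl)).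
  apply: (@existT_inj _ X); apply: finj; last exact: fg.
    exact/mem_set/gs.
  exact/mem_set.
have gact j k (c : hom j k) n : exists m, g k m = act X c (g j n).
  apply: gsurj; apply: (reachable_succ (gs j n)); left.
  by exists k, c.
have gstr j n c o k (y : X k) :
    Nset_set (coalg_str X j (g j n)) (c, o, existT _ k y) -> exists m, g k m = y.
  move=> ny; apply: gsurj; apply: (reachable_succ (gs j n)); right.
  by exists c, o.
exists (NatCoalgebra (coalg_str (restr_coalg ginj gact gstr))).
exists (restr_hom ginj gact gstr).
by have [n] := gsurj i x (reachable_refl s); exists n.
Qed.

Definition universal_coalg : coalgebra F := quot_coalg (coprod_coalg coalg_of).

(** Both [x] and [z] are images of one state of a coalgebra on subsets of nat, and morphisms
    preserve bisimilarity classes. *)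
Lemma universal_coalg_bisimilar (cC : countable [set: arrow C])
    (X : coalgebra F) i (x : X i) :
  exists z : universal_coalg i, @bisimilar _ _ X universal_coalg i x z.
Proof.
have [s [f [y <-]]] := nat_coalgebra_cover cC x.
exists (coalg_comp (coprod_hom coalg_of s) (quot_hom _) i y).
apply: bisimilar_trans (coalg_hom_bisimilar _ _).
by apply: bisimilar_sym; exact: coalg_hom_bisimilar.
Qed.

(** Bisimilar states of the quotient are equal, so each [x] has exactly one bisimilar state there.
    Sending [x] to it respects operations and is a functional bisimulation, hence a morphism; any
    morphism sends [x] to a bisimilar state, hence agrees with it. *)
Lemma universal_coalg_final :
  countable [set: arrow C] -> final_coalgebra universal_coalg.
Proof.
move=> cC X; pose U := universal_coalg.
pose f i (x : X i) : U i := sval (cid (universal_coalg_bisimilar cC x)).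
have fP i (x : X i) : @bisimilar _ _ X U i x (f i x).
  exact: svalP (cid (universal_coalg_bisimilar cC x)).
have f_unique i (x : X i) z : @bisimilar _ _ X U i x z -> f i x = z.
  move=> xz; apply: quot_coalg_bisimilar; apply: bisimilar_trans xz.
  exact/bisimilar_sym.
have f_act i j (c : hom i j) (x : X i) : f j (act X c x) = act U c (f i x).
  by apply: f_unique; have [+ _ _] := bisimilar_bisimulation (fP i x); apply.
have [|h hf] := @coalg_hom_of_bisimulation X U (AlgHom f_act).
  move=> i x z /= <-; have [_ xf xb] := bisimilar_bisimulation (fP i x).
  split=> [j c|o k x' /xf[z' tz' xz']|o k z' /xb[x' tx' xz']].
  - exact: f_act.
  - by exists z' => //; exact: f_unique.
  - by exists x' => //; exact: f_unique.
exists h => g; apply: coalg_hom_ext => i x.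
by rewrite hf /=; apply/esym/f_unique; exact: coalg_hom_bisimilar.
Qed.

(** By uniqueness the morphism to [Z] factors through the quotient by bisimilarity, so it identifies
    bisimilar states. Conversely, two states with a common image are both bisimilar to it. *)
Lemma final_coalg_bisimilar (Z X : coalgebra F) (f : coalg_hom X Z) i (x y : X i) :
  final_coalgebra Z -> @bisimilar _ _ X X i x y <-> f i x = f i y.
Proof.
move=> Zf; split=> [/quot_hom_eq xy|fxy].
  have [h _] := Zf (quot_coalg X); have [u uE] := Zf X.
  by rewrite (uE f) -(uE (coalg_comp (quot_hom X) h)) /= [class_of x]xy.
apply: bisimilar_trans (coalg_hom_bisimilar f x) _.
by rewrite fxy; apply: bisimilar_sym; exact: coalg_hom_bisimilar.
Qed.

End Coalgebras.

(** * The system of the normalized coalgebra *)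

Section Normalized.
Variables (C : category) (O : Type) (I : context_system C O).
Variable T : inference_system C O.
Hypotheses (cC : countable [set: arrow C]) (cI : countable_degree I).
Hypotheses (ctb : N_countable T) (nz : normalizable T).
Hypothesis sndT : sound T (@alpha C O I).
Local Notation N := (normalized_coalgebra cC cI ctb nz sndT).

(** Soundness keeps all that is derivable from [alpha p] inside [alpha p]; conversely,
    normalizability lets every transition in [alpha p] be derived from its norm. *)
Lemma normalized_coalgebra_tr : cs_tr (system_of N) = cs_tr I.
Proof.
apply/seteqP; split=> -[[[i p] o] q] /=.
  move=> [s /covers_normr[t pt ts] sq].
  have := sndT pt (derives_trans ts sq).
  by rewrite /alpha /= !act_id.
move=> tpq; apply: covers_norml => //.
by rewrite /alpha /= act_id.
Qed.

Lemma normalized_coalgebra_bisimilar i (p q : I i) :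
  @bisimilar _ _ (system_of N) (system_of N) i p q <-> bisimilar p q.
Proof.
by split=> -[R bR Rpq]; exists R => // j x y /bR; rewrite normalized_coalgebra_tr.
Qed.

End Normalized.

Theorem mainTheorem4 (C : category) (O : Type) (I : context_system C O)
    (T : inference_system C O)
    (cC : countable [set: arrow C]) (cI : countable_degree I)
    (ctb : N_countable T) (nz : normalizable T)
    (sndT : sound T (@alpha C O I)) :
  (exists Z : coalgebra (N_functor ctb nz), final_coalgebra Z) /\
  forall Z : coalgebra (N_functor ctb nz), final_coalgebra Z ->
  forall bang : coalg_hom (normalized_coalgebra cC cI ctb nz sndT) Z,
  forall (i : C) (p q : I i),
    saturated_bisimilar p q <-> bang i p = bang i q.
Proof.
split; first by exists (universal_coalg ctb nz); exact: universal_coalg_final.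
move=> Z Zf bang i p q.
rewrite saturated_bisimilarE -(final_coalg_bisimilar bang p q Zf).
by symmetry; exact: normalized_coalgebra_bisimilar.
Qed.
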